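(* Let $H$ be a real Hilbert space, let $f:H\rightarrow H$, and let $C$ and $\Omega$ be nonempty, closed and convex subsets of $H$. Assume that (a) $f$ is monotone on $C$, i.e. $\langle f(x)-f(y),x-y\rangle\geq 0$ for all $x,y\in C$; (b) $f$ is Lipschitz continuous on $H$ with constant $\kappa>0$, i.e. $\Vert f(x)-f(y)\Vert\leq\kappa\Vert x-y\Vert$ for all $x,y\in H$; (c) $\Omega\cap SOL(C,f)\neq\emptyset$. Let $\{\lambda_k\}_{k=0}^{\infty}\subset[a,b]$ for some $a,b\in(0,1/\kappa)$ and let $\{\alpha_k\}_{k=0}^{\infty}\subset[c,d]$ for some $c,d\in(0,1)$. Let $x^0\in H$ be arbitrary and let the sequences $\{x^k\}_{k=0}^{\infty}$ and $\{y^k\}_{k=0}^{\infty}$ be generated, for all $k\geq 0$, by $$y^{k}=P_{C}(x^{k}-\lambda_{k}f(x^{k})),$$ $$T_{k}:=\{w\in H\mid\langle (x^{k}-\lambda_{k}f(x^{k}))-y^{k},\,w-y^{k}\rangle\leq 0\},$$ $$x^{k+1}=\alpha_{k}x^{k}+(1-\alpha_{k})P_{\Omega}\left(P_{T_{k}}(x^{k}-\lambda_{k}f(y^{k}))\right).$$ Then $\{x^k\}_{k=0}^{\infty}$ and $\{y^k\}_{k=0}^{\infty}$ converge weakly to the same point $z\in\Omega\cap SOL(C,f)$, and $$z=\lim_{k\rightarrow\infty}P_{\Omega\cap SOL(C,f)}(x^{k}).$$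
   Context: For a nonempty, closed and convex subset $D$ of a real Hilbert space $H$, $P_D$ denotes the metric (nearest point) projection of $H$ onto $D$. For $h:H\to H$, $SOL(D,h)$ denotes the solution set of the variational inequality problem: $SOL(D,h)=\{x^{\ast}\in D\mid\langle h(x^{\ast}),x-x^{\ast}\rangle\geq 0\text{ for all }x\in D\}$. The symbol $\lim$ refers to strong (norm) convergence. *)

(* Defs.v *)
From HB Require Import structures.
From mathcomp Require Import all_boot all_order all_algebra.
From mathcomp Require Import all_classical all_reals all_analysis.

Set Implicit Arguments.
Unset Strict Implicit.
Unset Printing Implicit Defensive.

Import Order.TTheory GRing.Theory Num.Theory.
Import numFieldNormedType.Exports.

Local Open Scope classical_set_scope.
Local Open Scope ring_scope.

(* {dot H for idfun} is the type of symmetric positive definite bilinear forms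
   on H; inner_normE makes the norm, hence the topology and completeness of
   completeNormedModType, those induced by the inner product. *)
HB.mixin Record CompleteNormedModule_isHilbert (R : realType) H
    of CompleteNormedModule R H := {
  inner : {dot H for (@idfun R)} ;
  inner_normE : forall x : H, inner x x = `|x| ^+ 2
}.

#[short(type="hilbertType")]
HB.structure Definition Hilbert (R : realType) :=
  {H of CompleteNormedModule_isHilbert R H & CompleteNormedModule R H}.

Section hilbert_defs.
Context {R : realType} {H : hilbertType R}.

Definition is_nearest_point (D : set H) (x p : H) : Prop :=
  D p /\ forall q, D q -> `|x - p| <= `|x - q|.

(* The default value 0 is only taken when x has no nearest point in D, which
   cannot happen for D nonempty, closed and convex. *)
Definition metric_proj (D : set H) (x : H) : H :=
  xget 0 [set p | is_nearest_point D x p].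

Definition SOL (D : set H) (h : H -> H) : set H :=
  [set x | D x /\ forall y, D y -> 0 <= inner (h x) (y - x)].

Definition monotone_op_on (D : set H) (h : H -> H) : Prop :=
  forall x y, D x -> D y -> 0 <= inner (h x - h y) (x - y).

Definition weakly_cvg (u : nat -> H) (z : H) : Prop :=
  forall phi : {linear H -> R^o}, continuous phi ->
    phi (u k) @[k --> \oo] --> phi z.

End hilbert_defs.

(* Main.v *)
(* The iterates are Fejer monotone with respect to F = Omega `&` SOL C f, and
   the decrease of |x_k - u|^2 controls |x_k - y_k|^2 and |x_k - s_k|^2, where
   s_k in Omega is the projected point, so both differences tend to 0.  Fejer
   monotonicity also makes p_k = P_F x_k a Cauchy sequence, with limit z.
   Weak sequential compactness is replaced by the fact that a decreasing
   sequence of nonempty bounded closed convex sets has a common point: if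
   phi (x_k) did not converge to phi z, there would be a point w <> z lying in
   every closed convex set that eventually contains the x_k.  All constraints
   needed on w are half-spaces: w in Omega and w in C through the projection of
   w, w in SOL C f through Minty's inequalities <f q, w - q> <= 0, and finally
   |w - z|^2 <= 0 through <x_k - p_k, w - p_k> <= 0. *)
Require Import Defs.
From HB Require Import structures.
From mathcomp Require Import all_boot all_order all_algebra.
From mathcomp Require Import all_classical all_reals all_analysis.
From mathcomp Require Import ring lra.
Import Order.TTheory GRing.Theory Num.Theory.
Import numFieldNormedType.Exports.
Local Open Scope classical_set_scope.
Local Open Scope ring_scope.

(** * Inner product calculus, Cauchy-Schwarz and continuity *)

Section inner_product.
Context {R : realType} {H : hilbertType R}.
Implicit Types u v w : H.

Lemma innerC u v : inner u v = inner v u.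
Proof. by rewrite hermC expr0 mul1r. Qed.

Lemma innerDl u v w : inner (u + v) w = inner u w + inner v w.
Proof. by rewrite linearDl. Qed.

Lemma innerDr w u v : inner w (u + v) = inner w u + inner w v.
Proof. by rewrite linearDr. Qed.

Lemma innerNl u v : inner (- u) v = - inner u v.
Proof. by rewrite linearNl. Qed.

Lemma innerNr u v : inner u (- v) = - inner u v.
Proof. by rewrite linearNr. Qed.

Lemma innerZl t u v : inner (t *: u) v = t * inner u v.
Proof. by rewrite linearZl_LR. Qed.

Lemma innerZr t u v : inner u (t *: v) = t * inner u v.
Proof. by rewrite linearZr_LR. Qed.

Definition innerE :=
  (innerDl, innerDr, innerNl, innerNr, innerZl, innerZr).

Lemma sqr_norm u : `|u| ^+ 2 = inner u u.
Proof. by rewrite inner_normE. Qed.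

(** The squared norm of [|v| *: u - |u| *: v] equals [2 |u| |v| (|u| |v| - <u, v>)], and [2 |u| |v|]
    is positive for nonzero vectors. The lower bound on [inner u v] comes from applying the lemma to
    [- u]. *)
Lemma CauchySchwarz_inner u v : inner u v <= `|u| * `|v|.
Proof.
have [->|u0] := eqVneq u 0; first by rewrite linear0l normr0 mul0r.
have [->|v0] := eqVneq v 0; first by rewrite linear0r normr0 mulr0.
have uv0 : 0 < `|u| * `|v| by rewrite mulr_gt0 ?normr_gt0.
have := sqr_ge0 `| `|v| *: u - `|u| *: v|.
rewrite sqr_norm !innerE (innerC v u) -!sqr_norm => h.
have : 0 <= 2 * (`|u| * `|v|) * (`|u| * `|v| - inner u v) by nra.
by rewrite pmulr_rge0 ?subr_ge0 //; lra.
Qed.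

Lemma continuous_inner h : continuous (inner h : H -> R).
Proof.
move=> u; apply/(@cvgrPdist_lt _ R^o) => e e0.
have h0 : 0 < `|h| + 1 by rewrite ltr_wpDl.
have e1 : 0 < e / (`|h| + 1) by rewrite divr_gt0.
near=> v.
have uv : `|u - v| < e / (`|h| + 1).
  by near: v; apply: (@cvgr_dist_lt _ _ _ _ _ id u).
have uv' : `|u - v| * (`|h| + 1) < e by rewrite -ltr_pdivlMr.
have lin : inner h u - inner h v = inner h (u - v) by rewrite !innerE.
have := CauchySchwarz_inner h (u - v).
have := CauchySchwarz_inner (- h) (u - v).
rewrite innerNl normrN lin => a1 a2.
rewrite ltr_norml; apply/andP; split; have := normr_ge0 (u - v); nra.
Unshelve. all: by end_near. Qed.

End inner_product.

(** Stands in for letting [t] tend to 0 in first-order arguments. If [a > 0], then [t = 1] gives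
    [b >= a > 0], so [t = a / (2 * b)] is admissible and yields [a <= a / 2]. *)
Lemma le0_of_le_scale {R : realFieldType} (a b : R) :
  (forall t, 0 < t -> t <= 1 -> a <= t * b) -> a <= 0.
Proof.
move=> h; rewrite leNgt; apply/negP => a0.
have b0 : a <= b by rewrite -(mul1r b); apply: h.
have bgt0 : 0 < b by lra.
have := h (a / (2 * b)); rewrite divr_gt0 ?mulr_gt0 // => /(_ isT).
rewrite ler_pdivrMr ?mulr_gt0 // => /(_ ltac:(lra)).
suff -> : a / (2 * b) * b = a / 2 by lra.
by field; rewrite gt_eqF.
Qed.

(** * Convex sets, closed sets and a Cauchy criterion *)

Section convexity.
Context {R : realType} {E : lmodType R}.

(** Trades [conv] over bundled elements of the unit interval for bare scalars, on which [lra] and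
    [nra] can work. *)
Lemma convex_setP (K : set E) :
  convex_set (K : set (convex_lmodType E)) <->
  forall t u v, 0 <= t -> t <= 1 -> K u -> K v -> K (t *: u + (1 - t) *: v).
Proof.
split=> [cK t u v t0 t1 Ku Kv|cK u v t].
  have := cK u v (Itv01 t0 t1); rewrite !inE => /(_ Ku Kv).
  by rewrite /conv /=.
by rewrite !inE => Ku Kv; rewrite /conv /=; apply: cK.
Qed.

Lemma convex_set_midpoint (K : set E) u v :
  convex_set (K : set (convex_lmodType E)) -> K u -> K v ->
  K (2^-1 *: (u + v)).
Proof.
move=> /convex_setP cK Ku Kv; rewrite scalerDr.
have e : (2^-1 : R) = 1 - 2^-1 by lra.
by rewrite {2}e; apply: cK => //; lra.
Qed.

Lemma convex_setI (K L : set E) :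
  convex_set (K : set (convex_lmodType E)) ->
  convex_set (L : set (convex_lmodType E)) ->
  convex_set (K `&` L : set (convex_lmodType E)).
Proof.
move=> /convex_setP cK /convex_setP cL; apply/convex_setP.
by move=> t u v t0 t1 [Ku Lu] [Kv Lv]; split; [exact: cK|exact: cL].
Qed.

End convexity.

Lemma convex_closed_ball_norm {R : realType} {V : normedModType R} (x : V) r :
  convex_set ([set v | `|x - v| <= r] : set (convex_lmodType V)).
Proof.
apply/convex_setP => t u v t0 t1 /= ur vr.
have -> : x - (t *: u + (1 - t) *: v) = t *: (x - u) + (1 - t) *: (x - v).
  rewrite !scalerBr addrACA -scalerDl -opprD.
  by rewrite (_ : t + (1 - t) = 1) ?scale1r //; lra.
apply: le_trans (ler_normD _ _) _; rewrite !normrZ !ger0_norm //; last by lra.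
nra.
Qed.

Lemma closed_le_continuous {R : realType} {V : topologicalType}
    (g : V -> R) r :
  continuous g -> closed [set v | g v <= r].
Proof.
move=> cg; rewrite (_ : mkset _ = g @^-1` [set s | s <= r]) //.
by apply: preimage_closed; [move=> ? _; exact: cg|exact: closed_le].
Qed.

Lemma closed_norm_le {R : realType} {V : normedModType R} (x : V) r :
  closed [set v | `|x - v| <= r].
Proof.
apply: closed_le_continuous => u; apply: cvg_norm.
by apply: cvgB; [exact: cvg_cst|exact: cvg_id].
Qed.

(** A Cauchy criterion in squared form, since the parallelogram identity and the projection
    inequality both bound squared distances. *)
Lemma cvg_of_sqr_dist_le {R : realType} {V : completeNormedModType R}
    (u : nat -> V) (e : nat -> R) :
  e k @[k --> \oo] --> 0 ->
  (forall n m, (n <= m)%N -> `|u n - u m| ^+ 2 <= e n) ->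
  cvgn u.
Proof.
move=> e0 ue; apply: cauchy_cvg; apply/cauchyP => eps eps0.
have eps2 : 0 < eps ^+ 2 by rewrite exprn_gt0.
have /cvgrPdist_lt /(_ _ eps2) [N _ hN] := e0.
exists (u N); exists N => // m /= Nm.
rewrite -ball_normE /= -(ltr_pXn2r (n := 2)) ?nnegrE ?(ltW eps0) //.
apply: le_lt_trans (ue _ _ Nm) _.
by have := hN N (leqnn N); rewrite sub0r normrN; apply: le_lt_trans; exact: ler_norm.
Qed.

(** * Nested closed convex sets and the metric projection *)

Section hilbert_geometry.
Context {R : realType} {H : hilbertType R}.

Lemma convex_inner_le (h : H) r :
  convex_set ([set v | inner h v <= r] : set (convex_lmodType H)).
Proof. apply/convex_setP => t u v t0 t1 /=; rewrite !innerE; nra. Qed.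

Lemma closed_inner_le (h : H) r : closed [set v | inner h v <= r].
Proof. by apply: closed_le_continuous; exact: continuous_inner. Qed.

(* Near-minimizers of the norm in the successive sets form a Cauchy sequence
   by the parallelogram identity. *)
Lemma nested_convex_nonempty (K : nat -> set H) M :
  (forall n, K n !=set0) -> (forall n, closed (K n)) ->
  (forall n, convex_set (K n : set (convex_lmodType H))) ->
  (forall n m, (n <= m)%N -> K m `<=` K n) ->
  (forall v, K 0%N v -> `|v| <= M) ->
  exists w, forall n, K n w.
Proof.
move=> K0 Kclosed Kconvex Kdecr KM.
pose S n := [set `|v| ^+ 2 | v in K n].
have S0 n : S n !=set0 by have [v Kv] := K0 n; exists (`|v| ^+ 2); exists v.
have lbS n : has_lbound (S n) by exists 0 => _ [v _ <-]; rewrite exprn_ge0.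
have infS n : has_inf (S n) by split; [exact: S0|exact: lbS].
pose s n := inf (S n).
have sle n v : K n v -> s n <= `|v| ^+ 2.
  by move=> Kv; apply: ge_inf; [exact: lbS|exists v].
have s_nd : nondecreasing_seq s.
  move=> n m nm; apply: lb_le_inf; first exact: S0.
  by move=> _ [v Kv <-]; apply: sle; apply: Kdecr Kv.
have s_ub : has_ubound (range s).
  exists (M ^+ 2) => _ [n _ <-]; have [v Kv] := K0 n.
  apply: le_trans (sle _ _ Kv) _.
  have vM : `|v| <= M by apply: KM; exact: Kdecr Kv.
  by rewrite lerXn2r ?nnegrE // (le_trans _ vM).
have s_cvg := nondecreasing_is_cvgn s_nd s_ub.
have s_lim n : s n <= limn s by exact: nondecreasing_cvgn_le.
have near_min n : {v | K n v /\ `|v| ^+ 2 < s n + n.+1%:R^-1}.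
  apply: cid; have := inf_adherent (eps := n.+1%:R^-1) _ (infS n).
  by rewrite invr_gt0 ltr0Sn => /(_ isT) [_ [v Kv <-] lt]; exists v.
pose v n := sval (near_min n).
have Kv n : K n (v n) by rewrite /v; case: (near_min n) => ? [].
have vs n : `|v n| ^+ 2 < s n + n.+1%:R^-1.
  by rewrite /v; case: (near_min n) => ? [].
have v_cvg : cvgn v.
  apply: (@cvg_of_sqr_dist_le _ _ v
    (fun n => 2 * (limn s - s n) + 4 * n.+1%:R^-1)).
    rewrite -[X in _ --> X](_ : 2 * (limn s - limn s) + 4 * 0 = 0 :> R);
      last by rewrite subrr !mulr0 addr0.
    apply: cvgD; apply: cvgMr.
      by apply: cvgB; [exact: cvg_cst|exact: s_cvg].
    exact: (@cvg_harmonic R).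
  move=> n m nm.
  (* The midpoint of [v n] and [v m] lies in [K n], so its squared norm is at least [s n]. The
     parallelogram identity then bounds [|v n - v m|^2] by [2 (s m - s n)] plus twice each of the
     two errors; [s m <= limn s] and [m >= n] give the announced bound. *)
  have mid := sle _ _ (convex_set_midpoint _ _ _ (Kconvex n) (Kv n)
    (Kdecr _ _ nm _ (Kv m))).
  have sm := s_lim m; have vn := vs n; have vm := vs m.
  have : (m.+1%:R^-1 : R) <= n.+1%:R^-1.
    by rewrite lef_pV2 ?posrE ?ltr0Sn // ler_nat ltnS.
  move: (n.+1%:R^-1) (m.+1%:R^-1) mid vn vm => en em.
  rewrite !sqr_norm !innerE (innerC (v m) (v n)).
  by move=> *; lra.
exists (limn v) => n; apply: (closed_cvg _ (Kclosed n)) v_cvg.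
by exists n => // m /= nm; apply: Kdecr (Kv m).
Qed.

(** A nearest point is a common point of the sets obtained by cutting [D] with balls around [x]
    whose radii decrease to the distance from [x] to [D]. Its existence rules out the default value
    of [xget]. *)
Lemma metric_proj_nearest (D : set H) x :
  D !=set0 -> closed D -> convex_set (D : set (convex_lmodType H)) ->
  is_nearest_point D x (metric_proj D x).
Proof.
move=> D0 Dclosed Dconvex.
suff [w Dw] : exists w, is_nearest_point D x w.
  by rewrite /metric_proj; case: xgetP => [p _ //|/(_ w)].
pose S := [set `|x - v| | v in D].
have S0 : S !=set0 by have [v Dv] := D0; exists `|x - v|; exists v.
have lbS : has_lbound S by exists 0 => _ [v _ <-].
pose r n := inf S + n.+1%:R^-1.
have [|||||w Kw] := @nested_convex_nonempty
    (fun n => D `&` [set v | `|x - v| <= r n]) (`|x| + r 0%N).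
- move=> n.
  have [|_ [v Dv <-] vr] := @inf_adherent _ S n.+1%:R^-1 _ (conj S0 lbS).
    by rewrite invr_gt0 ltr0Sn.
  by exists v; split => //; exact: ltW.
- by move=> n; apply: closedI => //; exact: closed_norm_le.
- by move=> n; apply: convex_setI => //; exact: convex_closed_ball_norm.
- move=> n m nm v [Dv vr]; split=> //; apply: le_trans vr _.
  by rewrite lerD2l lef_pV2 ?posrE ?ltr0Sn // ler_nat ltnS.
- move=> v [_ vr].
  have -> : v = x - (x - v) by rewrite subKr.
  by apply: le_trans (ler_normB _ _) _; rewrite lerD2l.
exists w; split=> [|q Dq]; first by have [] := Kw 0%N.
apply: (@le_trans _ _ (inf S)); last by apply: ge_inf => //; exists q.
have r_cvg : r n @[n --> \oo] --> inf S.
  rewrite -[X in _ --> X]addr0; apply: cvgD; first exact: cvg_cst.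
  exact: (@cvg_harmonic R).
rewrite -(cvg_lim _ r_cvg) //; apply: limr_ge.
  by apply/cvg_ex; exists (inf S).
by apply: nearW => n; have [] := Kw n.
Qed.

(** Comparing the projection [p] with [t *: q + (1 - t) *: p] and dividing by [t] gives
    [2 <x - p, q - p> <= t |q - p|^2] for all small [t]. *)
Lemma inner_metric_proj_le0 (D : set H) x q :
  D !=set0 -> closed D -> convex_set (D : set (convex_lmodType H)) -> D q ->
  inner (x - metric_proj D x) (q - metric_proj D x) <= 0.
Proof.
move=> D0 Dclosed Dconvex Dq.
have [] := metric_proj_nearest D x D0 Dclosed Dconvex.
move: (metric_proj D x) => p Dp pmin.
suff : 2 * inner (x - p) (q - p) <= 0 by lra.
apply: (@le0_of_le_scale _ _ (`|q - p| ^+ 2)) => t t0 t1.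
have {}Dq : D (t *: q + (1 - t) *: p).
  by move/convex_setP: Dconvex; apply => //; exact: ltW.
have := pmin _ Dq; rewrite -(ler_pXn2r (n := 2)) ?nnegrE //.
have -> : x - (t *: q + (1 - t) *: p) = (x - p) - t *: (q - p).
  by rewrite scalerBr scalerBl scale1r !opprD !opprK -!addrA; congr (_ + _);
    rewrite addrCA; congr (_ + _); rewrite addrC.
rewrite !sqr_norm; move: (x - p) (q - p) => u v.
rewrite !innerE (innerC v u) => h.
have : 0 <= t * (t * inner v v - 2 * inner u v) by nra.
by rewrite pmulr_rge0 //; lra.
Qed.

(** Expanding [|x - q|^2] around the projection leaves a cross term whose sign is given by the
    variational characterization. *)
Lemma metric_proj_sqr_dist (D : set H) x q :
  D !=set0 -> closed D -> convex_set (D : set (convex_lmodType H)) -> D q ->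
  `|metric_proj D x - q| ^+ 2 <= `|x - q| ^+ 2 - `|x - metric_proj D x| ^+ 2.
Proof.
move=> D0 Dclosed Dconvex Dq.
have := inner_metric_proj_le0 D x q D0 Dclosed Dconvex Dq.
move: (metric_proj D x) => p.
by rewrite !sqr_norm !innerE (innerC p x) (innerC q p) (innerC q x); lra.
Qed.

End hilbert_geometry.

(** * Hull points of sequences and weak convergence *)

Section weak_convergence.
Context {R : realType} {H : hilbertType R}.

(* A substitute for weak cluster points that needs no weak compactness. *)
Definition hull_cluster (u : nat -> H) (w : H) :=
  forall K : set H, closed K -> convex_set (K : set (convex_lmodType H)) ->
    (\forall k \near \oo, K (u k)) -> K w.

Lemma hull_cluster_inner_le (u : nat -> H) w h r :
  hull_cluster u w ->
  (forall e, 0 < e -> \forall k \near \oo, inner h (u k) <= r + e) ->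
  inner h w <= r.
Proof.
move=> uw ur; apply/ler_addgt0Pr => e e0.
exact: (uw _ (closed_inner_le h (r + e)) (convex_inner_le h (r + e)) (ur e e0)).
Qed.

(** The nested sets are the closed convex hulls of the [A n], written as intersections of all closed
    convex supersets. The ball of radius [M] is one such superset of [A 0], so the hulls stay
    bounded. *)
Lemma decreasing_hull_point (A : nat -> set H) M :
  (forall n, A n !=set0) -> (forall n m, (n <= m)%N -> A m `<=` A n) ->
  (forall v, A 0%N v -> `|v| <= M) ->
  exists w, forall n (K : set H),
    closed K -> convex_set (K : set (convex_lmodType H)) -> A n `<=` K -> K w.
Proof.
move=> A0 Adecr AM.
pose P n (K : set H) :=
  [/\ closed K, convex_set (K : set (convex_lmodType H)) & A n `<=` K].
have [|||||w hw] := @nested_convex_nonempty _ _ (fun n => \bigcap_(K in P n) K) M.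
- by move=> n; have [v Av] := A0 n; exists v => K [_ _]; exact.
- by move=> n; apply: closed_bigI => K [].
- move=> n; apply/convex_setP => t u v t0 t1 Ku Kv K PK.
  by case: (PK) => _ /convex_setP cK _; apply: cK => //; [exact: Ku|exact: Kv].
- move=> n m nm v Kv K [Kcl Kcv AK]; apply: Kv; split => //.
  by apply: subset_trans AK; exact: Adecr.
- move=> v Kv; have /= := Kv [set v | `|0 - v| <= M]; rewrite sub0r normrN.
  apply; split; [exact: closed_norm_le|exact: convex_closed_ball_norm|].
  by move=> q /AM /=; rewrite sub0r normrN.
by exists w => n K Kcl Kcv AK; apply: (hw n).
Qed.

Lemma weakly_cvg_hull_cluster (u : nat -> H) z M :
  (forall k, `|u k| <= M) -> (forall w, hull_cluster u w -> w = z) ->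
  weakly_cvg u z.
Proof.
move=> uM uz.
(* A one-sided bound for every functional suffices: the other side is the same bound for [- phi]. *)
suff ub (phi : {linear H -> R^o}) : continuous phi -> forall e, 0 < e ->
    \forall k \near \oo, phi (u k) < phi z + e.
  move=> phi cphi; apply/cvgrPdist_le => e e0.
  have cN : continuous (\- phi : H -> R^o) by move=> v; apply: cvgN; exact: cphi.
  near=> k; rewrite ler_norml.
  have h1 : phi (u k) < phi z + e by near: k; exact: ub.
  have h2 : - phi (u k) < - phi z + e.
    by near: k; exact: (ub (\- phi : {linear H -> R^o})).
  by apply/andP; split; lra.
move=> cphi e e0; apply: contrapT => nub.
pose A n := [set v | exists2 k, (n <= k)%N & v = u k /\ phi z + e <= phi v].
have [|||w hw] := @decreasing_hull_point A M.
- move=> n; apply: contrapT => An; apply: nub; exists n => // k /= nk.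
  rewrite ltNge; apply/negP => uk; apply: An.
  by exists (u k); exists k.
- by move=> n m nm v [k mk uk]; exists k => //; exact: leq_trans mk.
- by move=> v [k _ [-> _]].
(* A closed convex set that eventually contains [u] contains some [A n], so [w] is a hull cluster
   point of [u] itself. But [w] also inherits [phi z + e <= phi w] from [A 0]. *)
have wz : w = z.
  apply: uz => K Kcl Kcv [n _ Ku]; apply: (hw n) => // v [k nk [-> _]].
  exact: Ku.
have : phi z + e <= phi w.
  rewrite -lerN2; apply: (hw 0%N [set v | - phi v <= - (phi z + e)]).
  - apply: (@closed_le_continuous _ H (\- phi)) => v; apply: cvgN; exact: cphi.
  - apply/convex_setP => t p q t0 t1 /=.
    by rewrite (linearD phi) !(linearZ_LR phi) /= /GRing.scale /=; nra.
  - by move=> v [k _ [_ h]] /=; rewrite lerN2.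
by rewrite wz; lra.
Unshelve. all: by end_near. Qed.

End weak_convergence.

(** * Monotone variational inequalities and one extragradient step *)

Section variational_inequality.
Context {R : realType} {H : hilbertType R}.
Variables (C : set H) (f : H -> H) (kappa : R).
Hypothesis C_convex : convex_set (C : set (convex_lmodType H)).
Hypothesis f_monotone : monotone_op_on C f.
Hypothesis f_lipschitz : kappa.-lipschitz f.

Lemma lipschitz_norm_le u v : `|f u - f v| <= kappa * `|u - v|.
Proof. exact: (f_lipschitz (u, v)). Qed.

(** Minty's lemma. Monotonicity gives one direction. For the other, the inequality is tested at
    [t *: q + (1 - t) *: w], and the Lipschitz bound makes the error of replacing [f p] by [f w] at
    most [t * (kappa * |q - w|^2)]. *)
Lemma SOL_Minty w :
  SOL C f w <-> C w /\ forall q, C q -> 0 <= inner (f q) (q - w).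
Proof.
split=> -[Cw hw]; split=> // q Cq.
  by have := hw _ Cq; have := f_monotone _ _ Cq Cw; rewrite innerDl innerNl; lra.
rewrite -oppr_le0.
apply: (@le0_of_le_scale _ _ (kappa * `|q - w| ^+ 2)) => t t0 t1.
pose p := t *: q + (1 - t) *: w.
have Cp : C p by move/convex_setP: C_convex; apply => //; exact: ltW.
have pw : p - w = t *: (q - w).
  by rewrite /p scalerBl scale1r scalerBr [LHS]addrC addrCA addKr.
have := hw _ Cp; rewrite pw innerZr pmulr_rge0 // => h.
have := CauchySchwarz_inner (f p - f w) (q - w); rewrite innerDl innerNl.
have := lipschitz_norm_le p w; rewrite pw normrZ gtr0_norm // => lip cs.
have := ler_wpM2r (normr_ge0 (q - w)) lip; lra.
Qed.

(** Minty's inequalities are affine in the solution, whereas the defining ones evaluate [f] at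
    it. *)
Lemma convex_SOL : convex_set (SOL C f : set (convex_lmodType H)).
Proof.
apply/convex_setP => t u v t0 t1 /SOL_Minty[Cu hu] /SOL_Minty[Cv hv].
apply/SOL_Minty; split; first by move/convex_setP: C_convex; apply.
move=> q Cq; have := hu _ Cq; have := hv _ Cq; rewrite !innerE; nra.
Qed.

Lemma closed_SOL : closed C -> closed (SOL C f).
Proof.
move=> C_closed.
have -> : SOL C f =
    C `&` \bigcap_(q in C) [set w | inner (f q) w <= inner (f q) q].
  apply/seteqP; split=> w.
    move=> /SOL_Minty[Cw hw]; split=> // q /hw.
    by rewrite innerDr innerNr subr_ge0.
  move=> [Cw hw]; apply/SOL_Minty; split=> // q /hw /=.
  by rewrite innerDr innerNr subr_ge0.
apply: closedI => //; apply: closed_bigI => q _; exact: closed_inner_le.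
Qed.

(** The projection inequality for [T] at [u] is expanded around [y]. Minty's inequality at [y]
    discards the term in [u], and [t] lying in [T] replaces [x - y] by [lam *: f x], so that only
    [2 lam <f x - f y, t - y>] has to be absorbed. *)
Lemma subgradient_extragradient_step lam x y t u (T : set H) :
  C !=set0 -> closed C -> 0 <= lam -> SOL C f u ->
  y = metric_proj C (x - lam *: f x) ->
  T = [set w | inner ((x - lam *: f x) - y) (w - y) <= 0] ->
  t = metric_proj T (x - lam *: f y) ->
  `|t - u| ^+ 2 <= `|x - u| ^+ 2 - (1 - (lam * kappa) ^+ 2) * `|x - y| ^+ 2.
Proof.
move=> C0 C_closed lam0 [Cu hu].
set v := x - lam *: f x => yE TE' tE.
have Cy : C y by rewrite yE; have [] := metric_proj_nearest C v C0 C_closed C_convex.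
have TE : T = [set w | inner (v - y) w <= inner (v - y) y].
  by rewrite TE'; apply/seteqP; split=> w; rewrite /= innerDr innerNr subr_le0.
have T_closed : closed T by rewrite TE; exact: closed_inner_le.
have T_convex : convex_set (T : set (convex_lmodType H)).
  by rewrite TE; exact: convex_inner_le.
(* The half-space [T] supports [C] at [y], hence contains all of [C]. *)
have Tu : T u by rewrite TE' yE; exact: inner_metric_proj_le0.
have T0 : T !=set0 by exists u.
have Tt : T t.
  by rewrite tE; have [] := metric_proj_nearest T (x - lam *: f y) T0 T_closed T_convex.
have := metric_proj_sqr_dist T (x - lam *: f y) u T0 T_closed T_convex Tu.
rewrite -tE.
have fyu : 0 <= lam * inner (f y) (y - u).
  by apply: mulr_ge0 => //; have /SOL_Minty[_] := conj Cu hu; exact.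
have cs : inner (f x - f y) (t - y) <= kappa * `|x - y| * `|t - y|.
  apply: le_trans (CauchySchwarz_inner _ _) _.
  by apply: ler_wpM2r => //; exact: lipschitz_norm_le.
have {}cs := ler_wpM2l lam0 cs.
(* Young's inequality, weighted so that [|t - y|^2] cancels exactly and only [|x - y|^2] keeps a
   coefficient. *)
have sq := sqr_ge0 (lam * kappa * `|x - y| - `|t - y|).
have {sq} : 2 * (lam * (kappa * `|x - y| * `|t - y|)) <=
    (lam * kappa) ^+ 2 * `|x - y| ^+ 2 + `|t - y| ^+ 2 by nra.
move: Tt fyu cs; rewrite TE' /v /=.
move: (f x) (f y) => fx fy.
move: (lam * (kappa * `|x - y| * `|t - y|)) => B.
rewrite !sqr_norm !innerE.
(* Each symmetric pair is put in a fixed order, so that [lra] meets a single atom for it. *)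
rewrite ?(innerC y x) ?(innerC t x) ?(innerC u x) ?(innerC t y) ?(innerC u y) ?(innerC u t).
rewrite ?(innerC x fx) ?(innerC y fx) ?(innerC t fx) ?(innerC u fx).
rewrite ?(innerC x fy) ?(innerC y fy) ?(innerC t fy) ?(innerC u fy) ?(innerC fy fx).
by move=> *; lra.
Qed.

End variational_inequality.

(** * Null sequences and Fejer monotone sequences *)

Lemma near_scale_norm_le {R : realType} {V : normedModType R} (u : nat -> V) B e :
  u k @[k --> \oo] --> 0 -> 0 < e -> \forall k \near \oo, B * `|u k| <= e.
Proof.
move=> u0 e0; have B0 : 0 < `|B| + 1 by rewrite ltr_wpDl.
have eB : 0 < e / (`|B| + 1) by rewrite divr_gt0.
have /cvgrPdist_le /(_ _ eB) := u0; apply: filterS => k.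
rewrite sub0r normrN ler_pdivlMr // => uk.
have := ler_norm B; have := normr_ge0 (u k); nra.
Qed.

(** The sequence [a] decreases and is bounded below, so its consecutive differences, which dominate
    [s * |u k|^2], tend to 0. *)
Lemma cvg0_of_sqr_le_decrease {R : realType} {V : normedModType R}
    (a : nat -> R) (u : nat -> V) s :
  0 < s -> (forall k, 0 <= a k) ->
  (forall k, a k.+1 <= a k - s * `|u k| ^+ 2) ->
  u k @[k --> \oo] --> 0.
Proof.
move=> s0 a0 step.
have a_ni : nonincreasing_seq a.
  apply/nonincreasing_seqP => k; apply: le_trans (step k) _.
  by rewrite gerBl mulr_ge0 ?exprn_ge0 // ltW.
have a_cvg : cvgn a.
  by apply: nonincreasing_is_cvgn a_ni _; exists 0 => _ [k _ <-].
have d0 : a k - a k.+1 @[k --> \oo] --> 0.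
  rewrite -[X in _ --> X](subrr (limn a)); apply: cvgB => //.
  by rewrite (cvg_shiftS a).
apply/cvgrPdist_lt => e e0.
have se : 0 < s * e ^+ 2 by rewrite mulr_gt0 // exprn_gt0.
have /cvgrPdist_lt /(_ _ se) := d0; apply: filterS => k.
rewrite !sub0r !normrN => dk.
rewrite -(ltr_pXn2r (n := 2)) ?nnegrE ?(ltW e0) // -(ltr_pM2l s0).
have := step k; have := ler_norm (a k - a k.+1); lra.
Qed.

Section fejer.
Context {R : realType} {H : hilbertType R}.

(** The exact identity is kept because its last term is what later forces [x k - s k] to 0;
    convexity of the squared norm alone would lose it. *)
Lemma sqr_dist_convex_comb (t : R) (x s u : H) :
  `|t *: x + (1 - t) *: s - u| ^+ 2 =
  t * `|x - u| ^+ 2 + (1 - t) * `|s - u| ^+ 2 - t * (1 - t) * `|x - s| ^+ 2.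
Proof.
by rewrite !sqr_norm !innerE (innerC s x) (innerC u x) (innerC u s); ring.
Qed.

Lemma fejer_nonincreasing (x : nat -> H) u :
  (forall k, `|x k.+1 - u| <= `|x k - u|) ->
  forall n m, (n <= m)%N -> `|x m - u| <= `|x n - u|.
Proof.
by move=> h n m nm; apply: (nonincreasing_seqP (fun k => `|x k - u|)).1 nm.
Qed.

Lemma fejer_metric_proj_cvg (F : set H) (x : nat -> H) :
  F !=set0 -> closed F -> convex_set (F : set (convex_lmodType H)) ->
  (forall u, F u -> forall k, `|x k.+1 - u| <= `|x k - u|) ->
  exists2 z, F z & metric_proj F (x k) @[k --> \oo] --> z.
Proof.
move=> F0 Fcl Fcv fejer.
pose p k := metric_proj F (x k).
have pnear k : is_nearest_point F (x k) (p k) by exact: metric_proj_nearest.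
have Fp k : F (p k) by have [] := pnear k.
pose a k := `|x k - p k| ^+ 2.
have a_ni : nonincreasing_seq a.
  apply/nonincreasing_seqP => k; rewrite lerXn2r ?nnegrE //.
  by apply: le_trans ((pnear k.+1).2 _ (Fp k)) _; exact: fejer.
have a_lb : has_lbound (range a) by exists 0 => _ [k _ <-]; rewrite exprn_ge0.
have a_cvg := nonincreasing_is_cvgn a_ni a_lb.
have p_cvg : cvgn p.
  apply: (@cvg_of_sqr_dist_le _ _ p (fun k => a k - limn a)).
    by rewrite -[X in _ --> X](subrr (limn a)); apply: cvgB; [|exact: cvg_cst].
  (* The point [p n] of [F] is held fixed: projecting [x m] gives
     [|p m - p n|^2 <= |x m - p n|^2 - a m], and Fejer monotonicity at [p n] bounds the first term
     by [a n]. *)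
  move=> n m nm; rewrite distrC.
  apply: le_trans (metric_proj_sqr_dist F (x m) (p n) F0 Fcl Fcv (Fp n)) _.
  apply: lerB; last exact: nonincreasing_cvgn_ge.
  by rewrite lerXn2r ?nnegrE //; exact: fejer_nonincreasing (fejer _ (Fp n)) _ _ nm.
exists (limn p) => //.
by apply: (closed_cvg _ Fcl) p_cvg; apply: nearW.
Qed.

Lemma hull_cluster_fejer (F : set H) (x : nat -> H) z w :
  F !=set0 -> closed F -> convex_set (F : set (convex_lmodType H)) ->
  (forall u, F u -> forall k, `|x k.+1 - u| <= `|x k - u|) ->
  metric_proj F (x k) @[k --> \oo] --> z ->
  hull_cluster x w -> F w -> w = z.
Proof.
move=> F0 Fcl Fcv fejer pz xw Fw.
have pz0 : metric_proj F (x k) - z @[k --> \oo] --> 0.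
  by rewrite -[X in _ --> X](subrr z); apply: cvgB; [|exact: cvg_cst].
suff h : inner (w - z) w <= inner (w - z) z.
  apply/eqP; rewrite -subr_eq0 -normr_eq0 -sqrf_eq0 eq_le sqr_ge0 andbT.
  by rewrite sqr_norm innerDr innerNr subr_le0.
apply: hull_cluster_inner_le xw _ => e e0.
have := near_scale_norm_le _ (`|x 0%N - w| + `|w - z|) _ pz0 e0.
apply: filterS => k; move: (inner_metric_proj_le0 F (x k) w F0 Fcl Fcv Fw).
have [] := metric_proj_nearest F (x k) F0 Fcl Fcv.
move: (metric_proj F (x k)) => p Fp /(_ _ Fw) pw le0 small.
have dx := fejer_nonincreasing x w (fejer _ Fw) 0 k isT.
have c1 := CauchySchwarz_inner (x k - p) (p - z).
have c2 := CauchySchwarz_inner (w - z) (p - z).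
have m1 := ler_wpM2r (normr_ge0 (p - z)) (le_trans pw dx).
have : inner (w - z) (x k - z) <= e.
  (* The first summand is nonpositive by projection onto [F]; the other two carry the factor
     [p - z], which tends to 0, against bounded vectors. *)
  have -> : inner (w - z) (x k - z) = inner (x k - p) (w - p) +
      inner (x k - p) (p - z) + inner (w - z) (p - z).
    rewrite !innerE (innerC w (x k)) (innerC z (x k)) (innerC p w) (innerC p z).
    by ring.
  by lra.
by rewrite innerDr innerNr; lra.
Qed.

(** The half-space supporting [D] at the projection [p] of [w] contains every [v k] and, up to any
    [e], eventually every [u k]. Hence it contains [w], which gives [|w - p|^2 <= 0]. *)
Lemma hull_cluster_mem (D : set H) (u v : nat -> H) w :
  D !=set0 -> closed D -> convex_set (D : set (convex_lmodType H)) ->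
  (forall k, D (v k)) -> u k - v k @[k --> \oo] --> 0 ->
  hull_cluster u w -> D w.
Proof.
move=> D0 Dcl Dcv Dv uv uw.
have [Dp _] := metric_proj_nearest D w D0 Dcl Dcv.
have le0 k := inner_metric_proj_le0 D w (v k) D0 Dcl Dcv (Dv k).
move: (metric_proj D w) Dp le0 => p Dp le0.
suff h : inner (w - p) w <= inner (w - p) p.
  suff -> : w = p by [].
  apply/eqP; rewrite -subr_eq0 -normr_eq0 -sqrf_eq0 eq_le sqr_ge0 andbT.
  by rewrite sqr_norm innerDr innerNr subr_le0.
apply: hull_cluster_inner_le uw _ => e e0.
have := near_scale_norm_le _ `|w - p| _ uv e0; apply: filterS => k small.
have := le0 k; have := CauchySchwarz_inner (w - p) (u k - v k).
by rewrite !(innerDr (w - p)) !(innerNr (w - p)); lra.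
Qed.

Lemma hull_cluster_SOL (C : set H) (f : H -> H) kappa (x y : nat -> H)
    (lambda : nat -> R) a M w :
  C !=set0 -> closed C -> convex_set (C : set (convex_lmodType H)) ->
  monotone_op_on C f -> 0 < kappa -> kappa.-lipschitz f ->
  0 < a -> (forall k, a <= lambda k) -> (forall k, `|x k| <= M) ->
  (forall k, y k = metric_proj C (x k - lambda k *: f (x k))) ->
  x k - y k @[k --> \oo] --> 0 -> hull_cluster x w -> SOL C f w.
Proof.
move=> C0 Ccl Ccv fmon kappa0 flip a0 lam_ge xM yE xy xw.
have Cy k : C (y k).
  by rewrite yE; have [] := metric_proj_nearest C
    (x k - lambda k *: f (x k)) C0 Ccl Ccv.
have Cw : C w by exact: hull_cluster_mem xy xw.
apply/(SOL_Minty _ _ _ Ccv fmon flip); split=> // q Cq.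
rewrite innerDr innerNr subr_ge0.
apply: hull_cluster_inner_le xw _ => e e0.
(* Bounds [|q - y k|] as soon as [|x k - y k| <= 1]. *)
pose B := `|q| + M + 1.
have near1 := near_scale_norm_le _ 1 1 xy ltr01.
(* The three coefficients pay for replacing [x k] by [y k] against [f q], for replacing [f (y k)] by
   [f (x k)], and for the projection inequality divided by [lambda k >= a]. *)
have near2 := near_scale_norm_le _ (`|f q| + (kappa + a^-1) * B) e xy e0.
apply: filterS2 near1 near2 => k; rewrite mul1r => xy1 small.
have qy : `|q - y k| <= B.
  rewrite (_ : q - y k = q - x k + (x k - y k)); last by rewrite addrA subrK.
  apply: le_trans (ler_normD _ _) _; apply: lerD => //.
  by apply: le_trans (ler_normB _ _) _; rewrite lerD2l.
have lam0 : 0 < lambda k by exact: lt_le_trans (lam_ge k).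
have h1 := inner_metric_proj_le0 C (x k - lambda k *: f (x k)) q C0 Ccl Ccv Cq.
rewrite -yE in h1.
have B0 : 0 <= B by exact: le_trans qy.
have DB0 : 0 <= `|x k - y k| * B by rewrite mulr_ge0.
have h2 : - inner (x k - y k) (q - y k) <= `|x k - y k| * B.
  rewrite -innerNl -normrN; apply: le_trans (CauchySchwarz_inner _ _) _.
  exact: ler_wpM2l.
have h3 : - inner (f (x k)) (q - y k) <= a^-1 * (`|x k - y k| * B).
  rewrite mulrC ler_pdivlMr //; move: h1; rewrite addrAC innerDl innerNl innerZl => h1.
  have := lam_ge k; nra.
have h4 : inner (f (x k) - f (y k)) (q - y k) <= kappa * (`|x k - y k| * B).
  apply: le_trans (CauchySchwarz_inner _ _) _; rewrite mulrA.
  by apply: ler_pM => //; exact: lipschitz_norm_le.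
have h5 := fmon _ _ Cq (Cy k).
have h6 : inner (f q) (x k - y k) <= `|f q| * `|x k - y k|.
  exact: CauchySchwarz_inner.
move: small h3 h4 h5 h6; rewrite mulrDl -mulrA (mulrC B) mulrDl.
rewrite !(innerDl, innerNl) !(innerDr (f q)) !(innerNr (f q)); lra.
Qed.

End fejer.

(** * Uniform decrease along the iteration and passage to the limit *)

Theorem theorem4p5 (R : realType) (H : hilbertType R) (f : H -> H)
    (C Omega : set H)
    (C_neq0 : C !=set0) (C_closed : closed C)
    (C_convex : convex_set (C : set (convex_lmodType H)))
    (Omega_neq0 : Omega !=set0) (Omega_closed : closed Omega)
    (Omega_convex : convex_set (Omega : set (convex_lmodType H)))
    (f_monotone : monotone_op_on C f)
    (kappa : R) (kappa_gt0 : 0 < kappa) (f_lipschitz : kappa.-lipschitz f)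
    (sol_neq0 : Omega `&` SOL C f !=set0)
    (a b : R) (a_in : a \in `]0, 1 / kappa[) (b_in : b \in `]0, 1 / kappa[)
    (lambda : nat -> R) (lambda_in : forall k, lambda k \in `[a, b])
    (c d : R) (c_in : c \in `]0, 1[) (d_in : d \in `]0, 1[)
    (alpha : nat -> R) (alpha_in : forall k, alpha k \in `[c, d])
    (x0 : H) (x y : nat -> H) (T : nat -> set H)
    (x_init : x 0%N = x0)
    (y_def : forall k, y k = metric_proj C (x k - lambda k *: f (x k)))
    (T_def : forall k,
      T k = [set w | inner ((x k - lambda k *: f (x k)) - y k) (w - y k) <= 0])
    (x_step : forall k,
      x k.+1 = alpha k *: x k + (1 - alpha k) *:
        metric_proj Omega (metric_proj (T k) (x k - lambda k *: f (y k)))) :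
  exists z : H,
    [/\ (Omega `&` SOL C f) z,
        weakly_cvg x z,
        weakly_cvg y z &
        metric_proj (Omega `&` SOL C f) (x k) @[k --> \oo] --> z].
Proof.
have a0 : 0 < a by move: a_in; rewrite in_itv /= => /andP[].
have b1 : b < 1 / kappa by move: b_in; rewrite in_itv /= => /andP[].
have c0 : 0 < c by move: c_in; rewrite in_itv /= => /andP[].
have d1 : d < 1 by move: d_in; rewrite in_itv /= => /andP[].
have lam_a k : a <= lambda k by have := lambda_in k; rewrite in_itv /= => /andP[].
have lam_b k : lambda k <= b by have := lambda_in k; rewrite in_itv /= => /andP[].
have alpha_c k : c <= alpha k by have := alpha_in k; rewrite in_itv /= => /andP[].
have alpha_d k : alpha k <= d by have := alpha_in k; rewrite in_itv /= => /andP[].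
have b0 : 0 < b by exact: lt_le_trans a0 (le_trans (lam_a 0%N) (lam_b 0%N)).
have bk1 : b * kappa < 1 by rewrite -ltr_pdivlMr.
have bk0 : 0 < b * kappa by rewrite mulr_gt0.
(* A lower bound, uniform in [k], for the factor [1 - (lambda k * kappa) ^+ 2]; it is positive
   because [b < 1 / kappa]. *)
pose rho := 1 - (b * kappa) ^+ 2.
have rho0 : 0 < rho by rewrite /rho; nra.
pose F := Omega `&` SOL C f.
have F_closed : closed F by apply: closedI => //; exact: closed_SOL f_lipschitz _.
have F_convex : convex_set (F : set (convex_lmodType H)).
  by apply: convex_setI => //; exact: convex_SOL f_lipschitz.
pose t k := metric_proj (T k) (x k - lambda k *: f (y k)).
pose s k := metric_proj Omega (t k).
have s_Omega k : Omega (s k).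
  by have [] := metric_proj_nearest Omega (t k) Omega_neq0 Omega_closed Omega_convex.
have step u : F u -> forall k, `|x k.+1 - u| ^+ 2 <= `|x k - u| ^+ 2
    - (1 - d) * rho * `|x k - y k| ^+ 2 - c * (1 - d) * `|x k - s k| ^+ 2.
  move=> [Ou Su] k.
  have tu := @subgradient_extragradient_step _ _ _ _ _ C_convex f_monotone
    f_lipschitz (lambda k) (x k) (y k) (t k) u (T k) C_neq0 C_closed
    (le_trans (ltW a0) (lam_a k)) Su (y_def k) (T_def k) erefl.
  have su : `|s k - u| ^+ 2 <= `|t k - u| ^+ 2.
    have := metric_proj_sqr_dist Omega (t k) u Omega_neq0 Omega_closed
      Omega_convex Ou.
    by have := sqr_ge0 `|t k - s k|; rewrite -/(s k); lra.
  have lk : (lambda k * kappa) ^+ 2 <= (b * kappa) ^+ 2.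
    have lk0 : 0 <= lambda k * kappa.
      by rewrite mulr_ge0 ?ltW // (lt_le_trans a0).
    by rewrite lerXn2r ?nnegrE ?(ltW bk0) // ler_pM2r.
  have xy0 := sqr_ge0 `|x k - y k|; have xs0 := sqr_ge0 `|x k - s k|.
  have {}tu : `|t k - u| ^+ 2 <= `|x k - u| ^+ 2 - rho * `|x k - y k| ^+ 2.
    by have := ler_wpM2r xy0 lk; rewrite /rho; lra.
  rewrite x_step -/(t k) -/(s k) sqr_dist_convex_comb.
  have ac := alpha_c k; have ad := alpha_d k.
  have m1 : (1 - alpha k) * `|s k - u| ^+ 2 <=
      (1 - alpha k) * (`|x k - u| ^+ 2 - rho * `|x k - y k| ^+ 2).
    by apply: ler_wpM2l; [lra|exact: le_trans su tu].
  have m2 : (1 - d) * (rho * `|x k - y k| ^+ 2) <=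
      (1 - alpha k) * (rho * `|x k - y k| ^+ 2).
    by apply: ler_wpM2r; [rewrite mulr_ge0 // ltW|lra].
  (* Both ends of [[c, d]] matter here: [alpha k >= c] and [1 - alpha k >= 1 - d]. *)
  have m3 : c * (1 - d) * `|x k - s k| ^+ 2 <=
      alpha k * (1 - alpha k) * `|x k - s k| ^+ 2.
    by apply: ler_wpM2r => //; apply: ler_pM; lra.
  by lra.
have [u0 Fu0] := sol_neq0.
have coefy0 : 0 < (1 - d) * rho by apply: mulr_gt0 => //; lra.
have coefs0 : 0 < c * (1 - d) by apply: mulr_gt0 => //; lra.
have xy0 : x k - y k @[k --> \oo] --> 0.
  apply: (@cvg0_of_sqr_le_decrease _ _ (fun k => `|x k - u0| ^+ 2) _ _ coefy0).
    by move=> k; exact: sqr_ge0.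
  move=> k; apply: le_trans (step _ Fu0 k) _.
  by rewrite gerBl mulr_ge0 ?sqr_ge0 // ltW.
have xs0 : x k - s k @[k --> \oo] --> 0.
  apply: (@cvg0_of_sqr_le_decrease _ _ (fun k => `|x k - u0| ^+ 2) _ _ coefs0).
    by move=> k; exact: sqr_ge0.
  move=> k; apply: le_trans (step _ Fu0 k) _.
  by rewrite addrAC gerBl mulr_ge0 ?sqr_ge0 // ltW.
have fejer u : F u -> forall k, `|x k.+1 - u| <= `|x k - u|.
  move=> Fu k; rewrite -(ler_pXn2r (n := 2)) ?nnegrE //.
  apply: le_trans (step u Fu k) _; rewrite -addrA gerDl -opprD oppr_le0.
  by rewrite addr_ge0 // mulr_ge0 ?sqr_ge0 // ltW.
have [z Fz pz] := fejer_metric_proj_cvg F x sol_neq0 F_closed F_convex fejer.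
pose M := `|x 0%N - u0| + `|u0|.
have xM k : `|x k| <= M.
  rewrite -{1}(subrK u0 (x k)); apply: le_trans (ler_normD _ _) _.
  by rewrite lerD2r; exact: fejer_nonincreasing (fejer _ Fu0) 0 k isT.
have weak_x : weakly_cvg x z.
  apply: (@weakly_cvg_hull_cluster _ _ x z M xM) => w xw.
  apply: (hull_cluster_fejer _ _ _ _ sol_neq0 F_closed F_convex fejer pz xw).
  split; first exact: hull_cluster_mem Omega_neq0 Omega_closed Omega_convex s_Omega xs0 xw.
  exact: hull_cluster_SOL C_neq0 C_closed C_convex f_monotone kappa_gt0
    f_lipschitz a0 lam_a xM y_def xy0 xw.
exists z; split=> // phi cphi.
(* The weak limit carries over to [y] because [x k - y k] tends to 0 in norm and [phi] is continuous
   at 0. *)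
have -> : (fun k => phi (y k)) = fun k => phi (x k) - phi (x k - y k).
  by apply/funext => k; rewrite (linearB phi) subKr.
rewrite -[X in _ --> X]subr0 -(linear0 phi); apply: (@cvgB _ R^o).
  exact: weak_x.
exact: (continuous_cvg _ (cphi 0) xy0).
Qed.
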